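(* Let $q$ be a prime. Let $c, k, M$ be positive integers with $c < M < q$, and let $A(X) \in \mathbb{F}_q[X]$ be a nonzero polynomial with $\deg(A) < cq$ and $\mathsf{pdeg}(A) < k$. Then $$\left|\{\alpha \in \mathbb{F}_q : \mathsf{mult}(A, \alpha) \geq M\}\right| \leq \min\left( \frac{c}{M - c + 1}\cdot k + c,\; k\right).$$
   Context: For $A(X) \in \mathbb{F}_q[X]$, $A^{[\ell]}(X)$ is the $\ell$-th Hasse derivative (the coefficient of $Z^\ell$ in $A(X+Z)$ expanded in powers of $Z$). With $\Lambda(X) = X^q - X$, the $\ell$-th pseudoderivative is $A_{\langle \ell \rangle}(X) = A^{[\ell]}(X) \bmod \Lambda(X)$, and the pseudodegree is $\mathsf{pdeg}(A) = \max_{\ell \geq 0}\deg(A_{\langle \ell\rangle})$. For nonzero $A$ and $\alpha \in \mathbb{F}_q$, $\mathsf{mult}(A,\alpha)$ is the largest $r$ such that $(X-\alpha)^r$ divides $A(X)$. *)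

(* Defs.v *)
From mathcomp Require Import all_boot all_order all_algebra.
Set Implicit Arguments. Unset Strict Implicit. Unset Printing Implicit Defensive.
Import GRing.Theory.
Local Open Scope ring_scope.

(* Hasse derivative: MathComp's nderivn  p^`N(l)  (= coefficient of Z^l in p(X+Z)). *)
Definition Lambda (F : fieldType) (q : nat) : {poly F} := 'X^q - 'X.

Definition pseudoderiv (F : fieldType) (q l : nat) (A : {poly F}) : {poly F} :=
  A^`N(l) %% Lambda F q.

(* pseudodegree: max over l of deg(A_<l>); Hasse derivatives of order >= size A
   vanish, so the max over all l equals the max over l < size A.  Degree is
   (size p).-1 (the zero polynomial gets degree 0 here). *)
Definition pdeg (F : fieldType) (q : nat) (A : {poly F}) : nat :=
  (\max_(l < size A) (size (pseudoderiv q l A)).-1)%N.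

Definition mult (F : fieldType) (A : {poly F}) (a : F) : nat := mup a A.

(* Main.v *)
Require Import Defs.
From mathcomp Require Import all_boot all_order all_algebra perm finfield.
From mathcomp Require Import zify ring.
Import GRing.Theory Num.Theory.
Local Open Scope ring_scope.

(** Write [A = \sum_(i < c) B i * Lambda ^+ i]; the bound on the pseudoderivatives
    forces every [B i] to have degree below [k].  If [A] had more than [k] roots
    of multiplicity [c], then the [B i] would vanish one after the other, which
    gives the bound [k].

    For the other bound, expand the same sum in powers of [Lambda + 'X = 'X^q]
    and factor the coefficients over a basis [f s] of their span:
    [A = \sum_(s < r) f s * (w s \Po 'X^q)] with [r <= c].  At a root [a] of
    multiplicity [M < q] one has ['X^q = a + ('X - a) ^+ q], so that
    [\sum_s (w s).[a] *: f s] vanishes to order [M] at [a].  Unless [a] is a root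
    of all the [w s], which happens for fewer than [c] values of [a], the
    Wronskian of the [f s] then vanishes to order [M - r + 1] at [a].  This
    Wronskian is nonzero because the [f s] are linearly independent of degree
    below [q], and it divides an [r]-minor of a matrix whose entries are
    combinations of derivatives of the [B i], hence has degree at most
    [r * (k - 1)].  The independence argument needs [k + c - 1 <= q]; otherwise
    counting roots of [A] with multiplicity is enough. *)

Set Implicit Arguments.
Unset Strict Implicit.

(** * Wronskians in characteristic [q] *)

Definition wronskian_mx (F : fieldType) r (f : 'I_r -> {poly F}) : 'M_r :=
  \matrix_(s, j) (f s)^`(j).

Section PrimeChar.

Variables (F : fieldType) (q : nat).
Hypothesis charFq : q \in [pchar F].
Implicit Types p : {poly F}.

Lemma pchar_natr_neq0 n : (0 < n < q)%N -> n%:R != 0 :> F.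
Proof.
move=> /andP[n0 nq]; rewrite -(dvdn_pcharf charFq).
by apply/negP => /(dvdn_leq n0); rewrite leqNgt nq.
Qed.

Lemma coef_deriv0 p n : p^`() = 0 -> ~~ (q %| n)%N -> p`_n = 0.
Proof.
case: n => [|n] dp; first by rewrite dvdn0.
move=> qn; have /eqP := congr1 (fun p => p`_n) dp.
rewrite coef_deriv coef0 -mulr_natr mulf_eq0 -(dvdn_pcharf charFq) (negPf qn).
by rewrite orbF => /eqP.
Qed.

(** All exponents of [h] are multiples of [q] and [p] has degree below [q], so the terms of [h]
    times [p] fill disjoint blocks of exponents. *)
Lemma coefM_deriv0 (h p : {poly F}) n b :
  h^`() = 0 -> (size p <= q)%N -> (q %| n)%N -> (b < q)%N ->
  (h * p)`_(n + b) = h`_n * p`_b.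
Proof.
move=> dh sp qn bq; have nb : (n < (n + b).+1)%N by rewrite ltnS leq_addr.
rewrite coefM (bigD1 (Ordinal nb)) //= addKn big1 ?addr0 // => i ni.
have [qi|qi] := boolP (q %| i)%N; last by rewrite (coef_deriv0 dh qi) mul0r.
rewrite (@nth_default _ _ p) ?mulr0 //; apply: leq_trans sp _.
move: ni (ltn_ord i) qi; rewrite -val_eqE /= {nb}.
case: i => /= i _ neq lt /dvdnP[y iE]; case/dvdnP: qn => x nE; subst i n.
have yx : (y < x)%N.
  rewrite ltn_neqAle; apply/andP; split; first by apply: contra neq => /eqP->.
  rewrite -ltnS -(ltn_pmul2r (leq_ltn_trans (leq0n b) bq)) mulSn.
  by apply: leq_ltn_trans (_ : _ <= x * q + b)%N _; lia.
by have : (y.+1 * q <= x * q)%N; [rewrite leq_mul2r yx orbT | lia].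
Qed.

(* A kernel vector [g] of the Wronskian matrix can be differentiated, so by
   minimality the ratios [g s / g l] have derivative zero; multiplying by
   [g l ^+ q] turns them into polynomials in ['X^q], whose coefficients give a
   linear relation over [F] because the [f s] have degree below [q]. *)
Lemma det_wronskian_neq0 r (f : 'I_r -> {poly F}) :
    (forall s, (size (f s) <= q)%N) ->
    (forall a : 'I_r -> F, \sum_s a s *: f s = 0 -> forall s, a s = 0) ->
  \det (wronskian_mx f) != 0.
Proof.
elim: r f => [|r IH] f sf indep; first by rewrite det_mx00 oner_eq0.
have q_gt0 : (0 < q)%N by rewrite prime_gt0 // (pcharf_prime charFq).
pose w := widen_ord (leqnSn r); pose l := @ord_max r.
have liftE i : lift l i = w i by apply: ord_inj; rewrite lift_max.
have {}IH : \det (wronskian_mx (f \o w)) != 0.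
  apply: IH => [s|a a0 s]; first exact: sf.
  pose b (i : 'I_r.+1) := if unlift l i is Some j then a j else 0.
  have bw i : b (w i) = a i.
    by rewrite /b -liftE liftK.
  rewrite -bw; apply: indep; rewrite big_ord_recr /= /b unlift_none scale0r addr0.
  by rewrite -[RHS]a0; apply: eq_bigr => i _; rewrite -/(w i) -/(b (w i)) bw.
have ker0 (u : 'I_r -> {poly F}) :
    (forall j : 'I_r, \sum_s u s * (f (w s))^`(j) = 0) -> forall s, u s = 0.
  move=> u0 s; apply/eqP; apply: contraT => us.
  case/negP: IH; apply/det0P; exists (\row_s u s).
    by apply: contra us => /eqP/rowP/(_ s); rewrite !mxE => ->.
  apply/rowP => j; rewrite !mxE.
  by under eq_bigr do rewrite !mxE; exact: u0.
apply/negP => /det0P[v v0 vW]; pose g s := v 0 s.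
have gf j : (j < r.+1)%N -> \sum_s g s * (f s)^`(j) = 0.
  move=> jr; have := congr1 (fun M : 'rV__ => M 0 (Ordinal jr)) vW.
  by rewrite !mxE; under eq_bigr do rewrite mxE.
have gl0 : g l != 0.
  apply: contra v0 => /eqP gl; apply/eqP/rowP => s; rewrite mxE -/(g s).
  have gw i : g (w i) = 0.
    apply: (ker0 (g \o w)) => j; have := gf j (ltnW (ltn_ord j)).
    by rewrite big_ord_recr /= gl mul0r addr0.
  case: (unliftP l s) => [j ->|-> //].
  by rewrite liftE gw.
(* Differentiate relation [j] and subtract relation [j.+1]; this is why [j] must stay below [r]. *)
have dgf j : (j < r)%N -> \sum_s (g s)^`() * (f s)^`(j) = 0.
  move=> jr; have := congr1 deriv (gf j (ltnW jr)).
  rewrite raddf_sum raddf0 /=; under eq_bigr do rewrite derivM -(derivnS (f _)).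
  by rewrite big_split (gf j.+1 jr) [LHS]addr0.
(* The differences of the two sides have last coordinate zero and solve the system for the first [r]
   polynomials. *)
have ratio s : g l * (g s)^`() = (g l)^`() * g s.
  apply/eqP; rewrite -subr_eq0; apply/eqP.
  case: (unliftP l s) => [j ->|->]; last by rewrite mulrC subrr.
  rewrite liftE.
  apply: (ker0 (fun j => g l * (g (w j))^`() - (g l)^`() * g (w j))) => {}j.
  transitivity (g l * (\sum_s (g s)^`() * (f s)^`(j))
                - (g l)^`() * \sum_s g s * (f s)^`(j)); last first.
    rewrite (dgf _ (ltn_ord j)) (gf _ (ltnW (ltn_ord j))). by rewrite !mulr0 subrr.
  rewrite !big_ord_recr /= !mulrDr !mulr_sumr opprD addrACA -sumrB.
  rewrite [X in _ = _ + X](_ : _ = 0) ?addr0; last by rewrite -/l; ring.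
  by apply: eq_bigr => i _; rewrite -/(w i); ring.
pose h s := g s * g l ^+ q.-1.
have dh s : (h s)^`() = 0.
  rewrite derivM deriv_exp -mulr_natl; case: q charFq q_gt0 => [//|[|n]] cq _ /=.
    by have := pcharf_prime cq.
  (* Here [n] is [q - 2]; since [q - 1] is [-1], the derivative of [h s] is the difference in
     [ratio] times [g l ^+ n]. *)
  have -> : n.+1%:R = -1 :> {poly F}.
    apply/eqP; rewrite -subr_eq0 opprK natr1 -polyC_natr.
    by rewrite (pcharf0 cq).
  transitivity ((g l * (g s)^`() - (g l)^`() * g s) * g l ^+ n).
    by rewrite exprS; ring.
  by rewrite ratio subrr mul0r.
have hf : \sum_s h s * f s = 0.
  transitivity (g l ^+ q.-1 * \sum_s g s * (f s)^`(0)); last by rewrite gf ?mulr0.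
  by rewrite mulr_sumr; apply: eq_bigr => i _; rewrite derivn0 /h; ring.
have hl0 : h l != 0 by rewrite mulf_neq0 ?expf_neq0.
(* The coefficients of [hf] in degrees [n + b] with [b < q] give a relation among the [f s] whose
   coefficient at [l] is the leading one of [h l]. *)
pose n := (size (h l)).-1.
have hln : (h l)`_n != 0 by rewrite -lead_coefE lead_coef_eq0.
have qn : (q %| n)%N by apply: contraNT hln => /(coef_deriv0 (dh l))->.
case/eqP: hln; apply: (indep (fun s => (h s)`_n)).
apply/polyP => b; rewrite coef0 coef_sum.
have [bq|qb] := ltnP b q; last first.
  by apply: big1 => s _; rewrite coefZ (nth_default _ (leq_trans (sf s) qb)) mulr0.
have := congr1 (fun p => p`_(n + b)) hf; rewrite coef0 coef_sum.
by under eq_bigr do rewrite coefM_deriv0 // -coefZ.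
Qed.

End PrimeChar.

(** * Multiplicity, degree bounds, Taylor expansion and rank factorization *)

Section Poly.

Variable F : fieldType.
Implicit Types p : {poly F}.

Lemma ltn_multiple_roots (rs : seq F) m p :
    p != 0 -> uniq rs -> (forall a, a \in rs -> ('X - a%:P) ^+ m %| p) ->
  (size rs * m < size p)%N.
Proof.
elim: rs p => [|a rs IH] p p0 /=; first by rewrite mul0n size_poly_gt0.
case/andP=> ars urs rs_dvd.
have /dvdpP[p' pE] := rs_dvd a (mem_head _ _).
have p'0 : p' != 0 by apply: contraNneq p0 => p'0; rewrite pE p'0 mul0r.
have Xm0 : ('X - a%:P) ^+ m != 0 by rewrite expf_neq0 // polyXsubC_eq0.
rewrite pE size_mul // size_exp_XsubC addnS mulSn addnC ltn_add2r; apply: IH => // b brs.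
have /rs_dvd : b \in a :: rs by rewrite inE brs orbT.
rewrite pE Gauss_dvdpl //; apply/coprimep_expl/coprimep_expr/coprimep_XsubC2.
by rewrite subr_eq0; apply: contraNneq ars => ->.
Qed.

Lemma size_add_leq (p1 p2 : {poly F}) k :
  (size p1 <= k -> size p2 <= k -> size (p1 + p2)%R <= k)%N.
Proof.
by move=> k1 k2; apply: leq_trans (size_polyD _ _) _; rewrite geq_max k1.
Qed.

Lemma size_sum_leq (I : finType) (f : I -> {poly F}) k :
  (forall i, size (f i) <= k)%N -> (size (\sum_i f i)%R <= k)%N.
Proof. by move=> fk; apply: leq_trans (size_sum _ _ _) _; apply/bigmax_leqP. Qed.

Lemma size_det_leq n (M : 'M[{poly F}]_n) k :
  (forall i j, size (M i j) <= k)%N -> (size (\det M) <= (n * k.-1).+1)%N.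
Proof.
move=> Mk; apply: size_sum_leq => s; rewrite size_Msign.
apply: leq_trans (size_poly_prod_leq _ _) _; rewrite cardT size_enum_ord.
have : (\sum_i size (M i (s i)) <= n * k)%N.
  by apply: leq_trans (leq_sum _ (fun i _ => Mk _ _)) _; rewrite sum_nat_const card_ord.
by move: (\sum_i _)%N => S; case: k {Mk} => [|k]; rewrite ?mulnS ?muln0 /=; lia.
Qed.

Lemma size_deriv_leq p k : (size p <= k)%N -> (size p^`() <= k)%N.
Proof.
move=> pk; have [->|p0] := eqVneq p 0; first by rewrite raddf0 size_poly0.
exact: leq_trans (ltnW (lt_size_deriv p0)) pk.
Qed.

Lemma size_derivn_leq p k l : (size p <= k)%N -> (size p^`(l) <= k)%N.
Proof. by elim: l p => [//|l IH] p pk; rewrite derivSn IH // size_deriv_leq. Qed.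

Lemma deriv_nderivn p i : (p^`N(i))^`() = p^`N(i.+1) *+ i.+1.
Proof.
apply/polyP => a; rewrite coefMn coef_deriv !coef_nderivn addSn addnS -!mulrnA.
congr (_ *+ _).
have := mul_bin_left (i + a).+1 i; rewrite subSn ?leq_addr // addKn; lia.
Qed.

Lemma dvdp_deriv_XsubC (a : F) m p :
  ('X - a%:P) ^+ m.+1 %| p -> ('X - a%:P) ^+ m %| p^`().
Proof.
case/dvdpP=> u ->; rewrite derivM deriv_exp /= exprS.
rewrite dvdp_add //; first by rewrite mulrA dvdp_mull.
by rewrite mulrnAr -mulrnAl mulrA dvdp_mull.
Qed.

Lemma dvdp_derivn_XsubC (a : F) m l p :
  ('X - a%:P) ^+ (m + l) %| p -> ('X - a%:P) ^+ m %| p^`(l).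
Proof.
elim: l p => [|l IH] p; first by rewrite addn0.
by rewrite addnS => /dvdp_deriv_XsubC/IH; rewrite derivSn.
Qed.

(** Taylor expansion: the outer ['X] is the increment, the constant ['X%:P] the base point. *)
Lemma coef_comp_XaddX p i : (p^:P \Po ('X + 'X%:P))`_i = p^`N(i).
Proof.
elim/poly_ind: p i => [|p a IH] i.
  by rewrite rmorph0 comp_poly0 coef0 linear0.
rewrite rmorphD rmorphM /= map_polyX map_polyC /= comp_polyD comp_polyM.
rewrite comp_polyX comp_polyC coefD mulrDr coefD coefMX coefMC coefC !IH.
case: i => [|i] /=; first by rewrite !nderivn0 add0r.
by rewrite nderivnMXaddC addr0.
Qed.

(** Each factor ['X - 'X%:P] raises the degree in the inner variable by at most one. *)
Lemma size_coef_comp_XsubX (P : {poly {poly F}}) k i :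
    (forall j, (size (P`_j)%R <= k)%N) ->
  (size ((P \Po ('X - 'X%:P))`_i)%R <= k + (size P).-1)%N.
Proof.
elim/poly_ind: P i => [|P b IH] i Pk.
  by rewrite comp_poly0 coef0 [X in (X <= _)%N]size_poly0.
have bk : (size b <= k)%N.
  by have := Pk 0%N; rewrite coefD coefMX coefC add0r.
have {}Pk j : (size (P`_j)%R <= k)%N.
  by have := Pk j.+1; rewrite coefD coefMX coefC addr0.
rewrite comp_polyD comp_polyM comp_polyX comp_polyC.
have [->|P0] := eqVneq P 0.
  rewrite comp_poly0 !mul0r !add0r coefC; case: ifP => _; last by rewrite size_poly0.
  by apply: leq_trans bk _; rewrite leq_addr.
rewrite size_MXaddC (negPf P0) /= mulrBr coefD coefB coefMX coefMC coefC.
have sP : (0 < size P)%N by rewrite size_poly_gt0.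
have {}IH j : (size ((P \Po ('X - 'X%:P))`_j)%R < k + size P)%N.
  by have := IH j Pk; lia.
apply: size_add_leq; last first.
  by case: ifP => _; rewrite ?size_poly0 //; apply: leq_trans bk _; rewrite leq_addr.
apply: size_add_leq; first by case: ifP => _; rewrite ?size_poly0 // ltnW.
rewrite size_polyN; apply: leq_trans (size_polyMleq _ _) _.
by rewrite size_polyX addn2 /=.
Qed.

(** A full-rank factorization of the coefficient matrix of [C]: the rows of [row_base] give the
    [f s], the columns of [col_base] the [w s]. *)
Lemma rank_factorization (c q : nat) (C : {poly {poly F}}) :
    (size C <= c)%N -> (forall i, (size (C`_i)%R <= q)%N) ->
  exists r (f w : 'I_r -> {poly F}), (r <= c)%N /\ [/\
    forall s, (size (f s) <= q)%N,
    forall a : 'I_r -> F, \sum_s a s *: f s = 0 -> forall s, a s = 0,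
    forall s, (size (w s) <= c)%N,
    row_full (\matrix_(i < c, s < r) (w s)`_i)
  & C = \sum_s (f s)%:P * (w s)^:P].
Proof.
move=> sC sCi; pose Phi : 'M[F]_(c, q) := \matrix_(i, a) C`_i`_a.
exists (\rank Phi), (fun s => rVpoly (row s (row_base Phi))).
exists (fun s => rVpoly (row s (col_base Phi)^T)); split; first exact: rank_leq_row.
split.
- by move=> s; exact: size_poly.
- move=> a; under eq_bigr do rewrite -linearZ /=; rewrite -linear_sum => /= a0 s.
  have := congr1 (@poly_rV _ q) a0; rewrite rVpolyK linear0.
  have -> : \sum_i a i *: row i (row_base Phi) = (\row_i a i) *m row_base Phi.
    by rewrite mulmx_sum_row; apply: eq_bigr => i _; rewrite mxE.
  move/eqP; rewrite (mulmx_free_eq0 _ (row_base_free Phi)) => /eqP/rowP/(_ s).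
  by rewrite !mxE.
- by move=> s; exact: size_poly.
- rewrite (_ : \matrix_(i, s) _ = col_base Phi) ?col_base_full //.
  by apply/matrixP => i s; rewrite !mxE coef_rVpoly_ord !mxE.
apply/polyP => i; apply/polyP => a; rewrite !coef_sum.
under eq_bigr do rewrite coefCM coef_map /= mulrC mul_polyC coefZ.
have [ic|ci] := ltnP i c; last first.
  rewrite (nth_default 0 (leq_trans sC ci)) coef0 big1 // => s _.
  by rewrite nth_default ?mul0r // (leq_trans (size_poly _ _)).
have [aq|qa] := ltnP a q; last first.
  rewrite (nth_default 0 (leq_trans (sCi i) qa)) big1 // => s _.
  by rewrite [X in _ * X]nth_default ?mulr0 // (leq_trans (size_poly _ _)).
have := congr1 (fun M : 'M_(c, q) => M (Ordinal ic) (Ordinal aq)) (mulmx_base Phi).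
rewrite !mxE /= => <-; apply: eq_bigr => s _.
by rewrite (coef_rVpoly_ord _ (Ordinal ic)) (coef_rVpoly_ord _ (Ordinal aq)) !mxE.
Qed.

End Poly.

(** * Degree and order of vanishing of the Wronskian *)

Section WronskianBounds.

Variable F : fieldType.

(** By the Leibniz rule, one more derivative on the [f s] costs a derivative of the whole sum and a
    multiple of the sum for [i.+1]. *)
Lemma size_sum_derivn_nderivn_leq r (f w : 'I_r -> {poly F}) k :
    (forall i, (size (\sum_s f s * (w s)^`N(i))%R <= k)%N) ->
  forall j i, (size (\sum_s (f s)^`(j) * (w s)^`N(i))%R <= k)%N.
Proof.
move=> H0; elim=> [|j IH] i; first exact: H0.
have -> : \sum_s (f s)^`(j.+1) * (w s)^`N(i) =
    (\sum_s (f s)^`(j) * (w s)^`N(i))^`()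
    - (\sum_s (f s)^`(j) * (w s)^`N(i.+1)) *+ i.+1.
  rewrite raddf_sum /= -sumrMnl -sumrB; apply: eq_bigr => s _.
  by rewrite derivM deriv_nderivn mulrnAr addrK.
apply: size_add_leq; first exact/size_deriv_leq/IH.
rewrite size_polyN -scaler_nat; exact: leq_trans (size_scale_leq _ _) (IH _).
Qed.

(* The rows [(f s)^`(j)] times the columns [(w s)^`N(i)] give a matrix with
   entries of size at most [k], and its minors are multiples of the
   Wronskian; some minor of [(w s)^`N(i)] survives the specialization at 0. *)
Lemma size_det_wronskian r c (f w : 'I_r -> {poly F}) k :
    row_full (\matrix_(i < c, s < r) (w s)`_i) ->
    (forall i, (size (\sum_s f s * (w s)^`N(i))%R <= k)%N) ->
  (size (\det (wronskian_mx f)) <= (r * k.-1).+1)%N.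
Proof.
move=> wfull fw; pose I := fullrankfun wfull.
pose K : 'M[{poly F}]_r := \matrix_(s, i) (w s)^`N(I i).
have K0 : \det K != 0.
  have : \det (map_mx (horner_eval (0 : F)) K) != 0.
    have := fullrowsub_unit wfull; rewrite unitmxE unitfE -det_tr.
    congr (\det _ != 0); apply/matrixP => s i.
    by rewrite !mxE /horner_eval horner_coef0 coef_nderivn addn0 binn.
  by apply: contraNneq; rewrite det_map_mx => ->; rewrite rmorph0.
have [->|W0] := eqVneq (\det (wronskian_mx f)) 0; first by rewrite size_poly0.
have := @size_det_leq _ _ ((wronskian_mx f)^T *m K) k.
rewrite det_mulmx det_tr => H; apply: leq_trans (H _); last first.
  move=> j i; rewrite mxE; under eq_bigr do rewrite !mxE.
  exact: size_sum_derivn_nderivn_leq.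
by rewrite dvdp_leq ?mulf_neq0 ?dvdp_mulr.
Qed.

(** The row [v] times the Wronskian matrix lists the derivatives of order below [r] of the
    combination; multiplying by the adjugate turns this row into [v] times the determinant. *)
Lemma dvdp_det_wronskian r (f : 'I_r -> {poly F}) (v : 'I_r -> F) a M s0 :
    (r <= M)%N -> v s0 != 0 -> ('X - a%:P) ^+ M %| \sum_s v s *: f s ->
  ('X - a%:P) ^+ (M - r).+1 %| \det (wronskian_mx f).
Proof.
move=> rM vs0 dv; pose u : 'rV[{poly F}]_r := \row_s (v s)%:P.
have uW j : ('X - a%:P) ^+ (M - r).+1 %| (u *m wronskian_mx f) 0 j.
  rewrite mxE (_ : \sum_s _ = (\sum_s v s *: f s)^`(j)).
    apply: dvdp_derivn_XsubC; apply: dvdp_trans dv; apply: dvdp_exp2l.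
    by have := ltn_ord j; lia.
  by rewrite linear_sum; apply: eq_bigr => s _; rewrite !mxE linearZ mul_polyC.
have -> : \det (wronskian_mx f) =
    (v s0)^-1 *: (u *m wronskian_mx f *m \adj (wronskian_mx f)) 0 s0.
  rewrite -mulmxA mul_mx_adj mul_mx_scalar !mxE mulrC mul_polyC scalerA.
  by rewrite mulVf ?scale1r.
rewrite dvdpZr ?invr_eq0 // mxE; apply: (big_ind (fun p => _ %| p)).
- exact: dvdp0.
- by move=> p1 p2; exact: dvdp_add.
- by move=> j _; rewrite dvdp_mulr.
Qed.

End WronskianBounds.

(** * Expansions in powers of [Lambda] *)

Section LambdaExpansion.

Variables (F : fieldType) (q : nat).
Hypothesis charFq : q \in [pchar F].
Implicit Types A : {poly F}.

Let q_gt1 : (1 < q)%N.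
Proof. exact: prime_gt1 (pcharf_prime charFq). Qed.

Lemma size_Lambda : size (Lambda F q) = q.+1.
Proof. by rewrite /Lambda size_polyDl size_polyXn // size_polyN size_polyX ltnS. Qed.

Lemma Lambda_neq0 : Lambda F q != 0.
Proof. by rewrite -size_poly_gt0 size_Lambda. Qed.

Lemma deriv_Lambda : (Lambda F q)^`() = -1.
Proof.
rewrite /Lambda derivB derivXn derivX -scaler_nat (pcharf0 charFq).
by rewrite scale0r sub0r.
Qed.

Lemma derivnM_Lambda A l :
  (A * Lambda F q)^`(l.+1) = A^`(l.+1) * Lambda F q - A^`(l) *+ l.+1.
Proof.
elim: l => [|l IH]; first by rewrite derivn1 derivM deriv_Lambda mulrN1.
rewrite derivnS IH derivB derivMn derivM deriv_Lambda -!derivnS.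
by rewrite mulrN1 [in RHS]mulrS opprD addrA.
Qed.

(** Let [A = A1 * Lambda + B0]. As [Lambda] has derivative [-1], the derivative of order [l.+1] of
    [A] is, modulo [Lambda], that of [B0] minus [l.+1] times the [l]-th one of [A1]. Since [l.+1] is
    invertible below [q], the bounds pass to [A1]. *)
Lemma Lambda_expansion c k A :
    (c <= q)%N -> (size A <= c * q)%N ->
    (forall l, (l < c)%N -> (size (A^`(l) %% Lambda F q)%R <= k)%N) ->
  exists2 B : nat -> {poly F}, forall i, (size (B i) <= k)%N
    & A = \sum_(i < c) B i * Lambda F q ^+ i.
Proof.
elim: c A => [|c IH] A cq sA Ak.
  exists (fun=> 0) => [i|]; first by rewrite size_poly0.
  by apply/eqP; rewrite big_ord0 -size_poly_leq0.
pose B0 := A %% Lambda F q; pose A1 := A %/ Lambda F q.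
have AE : A = A1 * Lambda F q + B0 by exact: divp_eq.
have B0k : (size B0 <= k)%N by exact: (Ak 0%N).
have [|l lc|B Bk A1E] := IH A1 (ltnW cq).
- by rewrite size_divp ?Lambda_neq0 // size_Lambda /= leq_subLR -mulSn.
- have mod_id (p : {poly F}) : (size p <= size B0)%N -> p %% Lambda F q = p.
    move=> pB; apply: modp_small; apply: leq_ltn_trans pB _.
    exact: ltn_modpN0 Lambda_neq0.
  have l0 : l.+1%:R != 0 :> F by apply: (pchar_natr_neq0 charFq); lia.
  have -> : A1^`(l) %% Lambda F q =
      l.+1%:R^-1 *: (B0^`(l.+1) - A^`(l.+1) %% Lambda F q).
    rewrite {1}AE derivnD derivnM_Lambda !modpD modp_mull add0r.
    rewrite (mod_id B0^`(l.+1)) ?size_derivn_leq // opprD addrCA subrr addr0.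
    by rewrite -modpN opprK -scaler_nat modpZl scalerA mulVf ?scale1r.
  apply: leq_trans (size_scale_leq _ _) _; apply: size_add_leq.
    exact: size_derivn_leq.
  by rewrite size_polyN Ak.
exists (fun i => if i is i'.+1 then B i' else B0) => [[|i] //|].
rewrite big_ord_recl expr0 mulr1 {1}AE A1E addrC; congr (_ + _).
by rewrite mulr_suml; apply: eq_bigr => i _; rewrite -mulrA -exprSr.
Qed.

(** The root [a] of [Lambda] is simple, because the derivative is [-1]. *)
Lemma dvdp_XsubC_Lambda (a : F) c A : a ^+ q = a ->
  ('X - a%:P) ^+ c.+1 %| A * Lambda F q -> ('X - a%:P) ^+ c %| A.
Proof.
move=> aq; have /factor_theorem[E LE] : root (Lambda F q) a.
  by rewrite /root !hornerE aq subrr.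
have Ea : ~~ root E a.
  have := congr1 (fun p => p.[a]) deriv_Lambda.
  rewrite LE derivM derivXsubC mulr1 !hornerE subrr mulr0 add0r /root => ->.
  by rewrite oppr_eq0 oner_eq0.
rewrite LE mulrA exprSr dvdp_mul2r ?polyXsubC_eq0 // Gauss_dvdpl //.
by apply: coprimep_expl; rewrite coprimep_sym coprimep_XsubC.
Qed.

(** On [rs] the sum agrees with [B 0], which thus has too many roots and is zero; cancelling one
    [Lambda] lowers the multiplicities by one. *)
Lemma Lambda_expansion_eq0 c k (B : nat -> {poly F}) (rs : seq F) :
    (forall i, (size (B i) <= k)%N) -> uniq rs -> (k <= size rs)%N ->
    (forall a, a \in rs -> a ^+ q = a) ->
    (forall a, a \in rs ->
       ('X - a%:P) ^+ c %| \sum_(i < c) B i * Lambda F q ^+ i) ->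
  \sum_(i < c) B i * Lambda F q ^+ i = 0.
Proof.
move=> + urs krs rsq; elim: c B => [|c IH] B Bk; first by rewrite big_ord0.
have -> : \sum_(i < c.+1) B i * Lambda F q ^+ i =
    (\sum_(i < c) B i.+1 * Lambda F q ^+ i) * Lambda F q + B 0%N.
  rewrite big_ord_recl expr0 mulr1 addrC mulr_suml; congr (_ + _).
  by apply: eq_bigr => i _; rewrite -mulrA -exprSr.
set A1 := \sum_(i < c) _ => dvdA.
have L0 a : a \in rs -> root (Lambda F q) a.
  by move=> /rsq aq; rewrite /root !hornerE aq subrr.
have B00 : B 0%N = 0.
  apply/eqP; apply: contraT => B00.
  suff: (size rs < size (B 0%N))%N by have := Bk 0%N; lia.
  apply: max_poly_roots => //; apply/allP => a ars.
  have : ('X - a%:P) %| A1 * Lambda F q + B 0%N.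
    by apply: dvdp_trans (dvdA a ars); rewrite exprS dvdp_mulr.
  by rewrite dvdp_XsubCl /root hornerD hornerM (eqP (L0 a ars)) mulr0 add0r.
rewrite B00 addr0 /A1 (IH (B \o succn)) ?mul0r // => [i|a ars]; first exact: Bk.
apply: dvdp_XsubC_Lambda (rsq a ars) _.
by have := dvdA a ars; rewrite B00 addr0.
Qed.

(** By Frobenius, [('X - a%:P) ^+ q] is ['X - a%:P] composed with ['X^q]. *)
Lemma dvdp_comp_Xq (a : F) (w : {poly F}) : a ^+ q = a ->
  ('X - a%:P) ^+ q %| (w \Po 'X^q) - w.[a]%:P.
Proof.
move=> aq; have qnat : [pchar {poly F}].-nat q.
  by rewrite pnatE ?(pcharf_prime charFq) // pchar_poly.
have -> : ('X - a%:P) ^+ q = ('X - a%:P) \Po 'X^q.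
  rewrite comp_polyB comp_polyX comp_polyC exprDn_pchar // exprNn_pchar //.
  by rewrite -polyC_exp aq.
have -> : (w \Po 'X^q) - w.[a]%:P = (w - w.[a]%:P) \Po 'X^q.
  by rewrite comp_polyB comp_polyC.
by apply: dvdp_comp_poly; rewrite dvdp_XsubCl /root !hornerE subrr.
Qed.

(* With [Y] standing for [Lambda], substituting [Y := U - X] makes [U] stand
   for ['X^q], which is the constant [a] to order [q] at [a]. *)
Lemma card_multiple_roots_Lambda_expansion c k M (B : nat -> {poly F})
    (rs : seq F) (A := \sum_(i < c) B i * Lambda F q ^+ i) :
    A != 0 -> (forall i, (size (B i) <= k)%N) -> (c < M)%N -> (M <= q)%N ->
    (k + c.-1 <= q)%N -> uniq rs ->
    (forall a, a \in rs -> a ^+ q = a) ->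
    (forall a, a \in rs -> ('X - a%:P) ^+ M %| A) ->
  (size rs * (M - c + 1) <= c * k + c * (M - c + 1))%N.
Proof.
move=> A0 Bk cM Mq kq urs rsq dvdA.
pose P := \poly_(i < c) B i; pose C := P \Po ('X - 'X%:P).
have sP : (size P <= c)%N by exact: size_poly.
have Pk i : (size (P`_i)%R <= k)%N.
  by rewrite coef_poly; case: ifP; rewrite ?size_poly0.
have sC : (size C <= c)%N.
  apply: leq_trans sP; rewrite /C.
  have [->|P0] := eqVneq P 0; first by rewrite comp_poly0.
  by rewrite size_comp_poly2 ?size_XsubC.
have sCi i : (size (C`_i)%R <= q)%N.
  apply: leq_trans (size_coef_comp_XsubX i Pk) _.
  by apply: leq_trans kq; rewrite leq_add2l -!subn1 leq_sub2r.
have AC : A = C.['X^q].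
  rewrite /C horner_comp !hornerE -/(Lambda F q) horner_poly.
  exact: eq_bigr.
have PC : P = C \Po ('X + 'X%:P).
  by rewrite /C -comp_polyA comp_polyB comp_polyX comp_polyC addrK comp_polyXr.
have [r [f [w [rc [sf findep sw wfull CE]]]]] := rank_factorization sC sCi.
(* Substituting back [U = Y + X] and Taylor expanding the [w s] identifies these sums with the
   coefficients of [P]. *)
have fwk i : (size (\sum_s f s * (w s)^`N(i))%R <= k)%N.
  suff -> : \sum_s f s * (w s)^`N(i) = P`_i by [].
  rewrite PC CE raddf_sum coef_sum; apply: eq_bigr => s _ /=.
  by rewrite comp_polyM comp_polyC coefCM coef_comp_XaddX.
have r_gt0 : (0 < r)%N.
  case: r f w {rc sf findep sw wfull fwk} CE => [|//] f w.
  by rewrite big_ord0 => C0; case/eqP: A0; rewrite AC C0 horner0.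
pose s0 := Ordinal r_gt0.
have w0 : w s0 != 0.
  apply/eqP => w0; have /row_fullP[D /matrixP/(_ s0 s0)/eqP] := wfull.
  rewrite !mxE eqxx big1 ?(eq_sym 0) ?oner_eq0 // => i _.
  by rewrite !mxE w0 coef0 mulr0.
have W0 := det_wronskian_neq0 charFq sf findep.
(* A single nonzero [w s0] suffices: it has fewer than [c] roots, and elsewhere the vector of the
   [(w s).[a]] is nonzero. *)
pose rs1 := [seq a <- rs | ~~ root (w s0) a].
pose rs2 := [seq a <- rs | root (w s0) a].
have s2 : (size rs2 < c)%N.
  apply: leq_trans (sw s0); apply: max_poly_roots; rewrite ?filter_uniq //.
  exact: filter_all.
have s1 : (size rs1 * (M - r).+1 < (r * k.-1).+1)%N.
  apply: leq_trans (size_det_wronskian wfull fwk).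
  apply: ltn_multiple_roots; rewrite ?filter_uniq // => a.
  rewrite mem_filter => /andP[wa ars].
  apply: (@dvdp_det_wronskian _ _ _ (fun s => (w s).[a]) _ _ s0) => //; first by lia.
  (* Both terms vanish to order [M] at [a], the second one because [M <= q]. *)
  have -> : \sum_s (w s).[a] *: f s =
      A - \sum_s f s * ((w s \Po 'X^q) - (w s).[a]%:P).
    rewrite AC CE horner_sum -sumrB; apply: eq_bigr => s _.
    by rewrite hornerM hornerC -[_.['X^q]]/(w s \Po 'X^q) -mul_polyC; ring.
  rewrite dvdp_sub ?dvdA //; apply: (big_ind (fun p => _ %| p)).
  - exact: dvdp0.
  - by move=> p1 p2; exact: dvdp_add.
  - move=> s _; apply: dvdp_mull; apply: dvdp_trans (dvdp_comp_Xq _ (rsq a ars)).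
    exact: dvdp_exp2l.
have srs : size rs = (size rs2 + size rs1)%N.
  by rewrite !size_filter -(count_predC (root (w s0))).
have h1 : (size rs1 * (M - c + 1) <= size rs1 * (M - r).+1)%N.
  by rewrite leq_mul2l; lia.
have h2 : (size rs2 * (M - c + 1) <= c * (M - c + 1))%N.
  by rewrite leq_mul2r; lia.
have h3 : (r * k.-1 <= c * k)%N by rewrite leq_mul // leq_pred.
by rewrite srs mulnDl addnC leq_add //; lia.
Qed.

End LambdaExpansion.

(** * From the pseudodegree to the bounds over ['F_q] *)

Lemma size_pseudoderiv_leq (F : fieldType) q l (A : {poly F}) :
  (size (pseudoderiv q l A) <= (pdeg q A).+1)%N.
Proof.
rewrite /pseudoderiv; have [lA|Al] := ltnP l (size A); last first.
  by rewrite nderivn_poly0 // mod0p size_poly0.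
have := @leq_bigmax _ (fun l : 'I_(size A) => (size (pseudoderiv q l A)).-1)
  (Ordinal lA).
by rewrite -/(pdeg q A) -ltnS /=; apply: leq_trans; exact: leqSpred.
Qed.

Unset Implicit Arguments.

Theorem theorem5p4 (q c k M : nat) (A : {poly 'F_q}) :
  prime q -> (0 < c)%N -> (0 < k)%N -> (0 < M)%N ->
  (c < M)%N -> (M < q)%N ->
  A != 0 -> (size A <= c * q)%N -> (pdeg q A < k)%N ->
  let N := #|[set a : 'F_q | (M <= mult A a)%N]| in
  (N%:R : rat) <= (c%:R / (M - c + 1)%:R) * k%:R + c%:R /\ (N <= k)%N.
Proof.
move=> q_prime c_gt0 k_gt0 M_gt0 cM Mq A0 sA Ak N.
have charFq := pchar_Fp q_prime.
have aq (a : 'F_q) : a ^+ q = a by rewrite -{2}(expf_card a) card_Fp.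
pose rs := enum [set a : 'F_q | (M <= mult A a)%N].
have urs : uniq rs by exact: enum_uniq.
have srs : size rs = N by rewrite -cardE.
have dvdA a : a \in rs -> ('X - a%:P) ^+ M %| A.
  by rewrite mem_enum inE /mult mup_geq.
have [|||B Bk AE] := @Lambda_expansion _ _ charFq c k A.
- by lia.
- exact: sA.
(* The usual derivative is a scalar multiple, by the factorial of [l], of the Hasse derivative. *)
- move=> l _; rewrite nderivn_def -scaler_nat modpZl.
  apply: leq_trans (size_scale_leq _ _) _.
  exact: leq_trans (size_pseudoderiv_leq q l A) Ak.
have Nk : (N <= k)%N.
  rewrite leqNgt; apply: contraNN A0 => kN; rewrite AE; apply/eqP.
  apply: (@Lambda_expansion_eq0 _ _ charFq c k B rs) => //.
    by rewrite srs ltnW.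
  move=> a /dvdA; rewrite -AE; apply: dvdp_trans; exact/dvdp_exp2l/ltnW.
split=> //.
have Nnat : (N * (M - c + 1) <= c * k + c * (M - c + 1))%N.
  have [kq|qk] := leqP (k + c.-1) q.
    rewrite -srs; apply: (@card_multiple_roots_Lambda_expansion _ _ charFq c k M B) => //.
    - by rewrite -AE.
    - exact: ltnW.
    - by move=> a /dvdA; rewrite -AE.
  (* Now [q <= k + (c - 2)], with [c - 2] truncated to 0 when [c = 1], so
     [N * M < c * k + c * (c - 2)]. For [N > c] the last term is at most [N * (c - 1)], which is the
     excess of [N * M] over [N * (M - c + 1)]. *)
  have NM : (N * M < c * q)%N.
    by rewrite -srs; apply: leq_trans sA; exact: ltn_multiple_roots.
  have cq : (c * q <= c * (k + (c - 2)))%N by rewrite leq_mul2l; lia.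
  have [Nc|cN] := leqP N c.
    by apply: leq_trans (leq_addl _ _); rewrite leq_mul2r Nc orbT.
  have cc : (c * (c - 2) <= N * (c - 1))%N by apply: leq_mul; lia.
  have MN : (N * M = N * (M - c + 1) + N * (c - 1))%N.
    by rewrite -mulnDr; congr (_ * _)%N; lia.
  rewrite -(leq_add2r (N * (c - 1))) -MN; apply: leq_trans (ltnW NM) _.
  apply: leq_trans cq _; rewrite mulnDr addnAC; apply: leq_trans (leq_addr _ _).
  by rewrite leq_add2l.
have m_gt0 : 0 < (M - c + 1)%:R :> rat by rewrite ltr0n addn1.
rewrite -(ler_pM2r m_gt0) mulrDl mulrAC mulfVK ?lt0r_neq0 //.
by rewrite -!natrM -natrD ler_nat.
Qed.
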